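(* Let $F=aX^3+bX^2Y+cXY^2+dY^3$ be a binary cubic form with rational coefficients and nonzero (positive or negative) discriminant, and let $\alpha,\beta,\gamma\in\mathbb{P}^1(\mathbb{C})$ be its roots. Embed the upper half plane $\mathbb{H}$ into hyperbolic upper half space $\mathbb{H}_3$ in the natural way, so that $\mathbb{P}^1(\mathbb{R})=\partial\mathbb{H}\subset\partial\mathbb{H}_3=\mathbb{P}^1(\mathbb{C})$. Then the attractor point in $\mathbb{H}$ associated to $F$ is the center of mass of $\alpha,\beta,\gamma$ inside $\mathbb{H}_3$.
   Context: **The model ($t^3$-model).** The moduli space is the upper half plane $\mathbb{H}$ with coordinate $\tau=x+iy$, carrying the variation of Hodge structure $\mathrm{Sym}^3$ of the weight one Hodge structure of the universal elliptic curve; a fibre is identified with the space of binary cubic forms. For a form $F$, put $Z(\tau)=F(\tau,1)=a\tau^3+b\tau^2+c\tau+d$ (the pairing of the charge with the holomorphic section $\Omega$ of $H^{3,0}$). With $e^{-K}=\tfrac43(\operatorname{Im}\tau)^3$ (so $K=-3\log\operatorname{Im}\tau+\mathrm{const}$), $DZ=\partial_\tau Z+(\partial_\tau K)Z$ and $g_{\tau\bar\tau}=\partial_\tau\partial_{\bar\tau}K=\frac{3}{4y^2}$, define $$V_{\mathrm{eff}}(\tau)=e^{K}\left[g^{\tau\bar\tau}|DZ|^2+|Z|^2\right].$$ The attractor points associated to $F$ are the critical points of $V_{\mathrm{eff}}$ on $\mathbb{H}$. They are called BPS if $F$ has positive discriminant (three real roots) and non-BPS if $F$ has negative discriminant (one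 real root and a pair of complex conjugate roots). In the BPS case the attractor point is equivalently the minimum of $|Z|^2/(\operatorname{Im}\tau)^3$. **Center of mass (Julia's covariant).** $\mathbb{H}_3=\{(t,u):t\in\mathbb{C},u>0\}$ and $\mathbb{H}\hookrightarrow\mathbb{H}_3$ is $x+iy\mapsto(x,y)$. The center of mass of three distinct points $\alpha,\beta,\gamma\in\mathbb{C}$ is the unique point $(t,u)\in\mathbb{H}_3$ minimizing $$\log\frac{|t-\alpha|^2+u^2}{u}+\log\frac{|t-\beta|^2+u^2}{u}+\log\frac{|t-\gamma|^2+u^2}{u}$$ (if a root is $\infty$, the corresponding term is replaced by $\log\frac1u$). It is equivariant under $SL_2(\mathbb{C})$, and lies in $\mathbb{H}$ when the set of roots is stable under complex conjugation. *)

(* Defs.v *)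
From Stdlib Require Export Reals QArith Qreals.
From Coquelicot Require Export Coquelicot.

Open Scope R_scope.

Record cubic_form : Set := Cubic { coef_a : Q; coef_b : Q; coef_c : Q; coef_d : Q }.

Definition discriminant (F : cubic_form) : Q :=
  let (a, b, c, d) := F in
  (b ^ 2 * c ^ 2 - 4 * a * c ^ 3 - 4 * b ^ 3 * d - 27 * a ^ 2 * d ^ 2
   + 18 * a * b * c * d)%Q.

Definition eval_form (F : cubic_form) (X Y : C) : C :=
  let (a, b, c, d) := F in
  (Q2R a * X ^ 3 + Q2R b * X ^ 2 * Y + Q2R c * X * Y ^ 2 + Q2R d * Y ^ 3)%C.

(* [Some z] is the point [z : 1] and [None] is the point [1 : 0] at infinity. *)
Definition P1C : Type := option C.

Definition linear_form (p : P1C) (X Y : C) : C :=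
  match p with
  | Some z => (X - z * Y)%C
  | None => Y
  end.

(* The roots are listed with multiplicity. *)
Definition roots (F : cubic_form) (alpha beta gamma : P1C) : Prop :=
  exists l : C, l <> RtoC 0 /\
    forall X Y : C,
      eval_form F X Y =
      (l * linear_form alpha X Y * linear_form beta X Y * linear_form gamma X Y)%C.

Definition upper_half_plane (tau : C) : Prop := 0 < Im tau.

(* The Wirtinger operators d/dtau = (d/dx - i d/dy) / 2 and
   d/dtaubar = (d/dx + i d/dy) / 2, where tau = x + i y.  [Derive] is total;
   these operators are only meaningful where f is differentiable, which is the
   case on the upper half plane for every function they are applied to below. *)
Definition partial_x (f : C -> C) (tau : C) : C :=
  (Derive (fun x => Re (f (x, Im tau))) (Re tau),
   Derive (fun x => Im (f (x, Im tau))) (Re tau)).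

Definition partial_y (f : C -> C) (tau : C) : C :=
  (Derive (fun y => Re (f (Re tau, y))) (Im tau),
   Derive (fun y => Im (f (Re tau, y))) (Im tau)).

Definition d_tau (f : C -> C) (tau : C) : C :=
  ((partial_x f tau - Ci * partial_y f tau) / 2)%C.

Definition d_taubar (f : C -> C) (tau : C) : C :=
  ((partial_x f tau + Ci * partial_y f tau) / 2)%C.

Definition central_charge (F : cubic_form) (tau : C) : C := eval_form F tau (RtoC 1).

(* Normalised by exp (- K) = 4/3 (Im tau)^3. *)
Definition kahler_potential (tau : C) : R := - ln (4 / 3 * Im tau ^ 3).

Definition D_central_charge (F : cubic_form) (tau : C) : C :=
  (d_tau (central_charge F) tau
   + d_tau (fun s => RtoC (kahler_potential s)) tau * central_charge F tau)%C.

(* The value is real, being a quarter of the Laplacian of the Kahler potential. *)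
Definition kahler_metric (tau : C) : R :=
  Re (d_tau (d_taubar (fun s => RtoC (kahler_potential s))) tau).

Definition V_eff (F : cubic_form) (tau : C) : R :=
  exp (kahler_potential tau) *
  (/ kahler_metric tau * Cmod (D_central_charge F tau) ^ 2
   + Cmod (central_charge F tau) ^ 2).

(* A critical point is one where the real differential exists and vanishes. *)
Definition critical_point (V : C -> R) (tau : C) : Prop :=
  filterdiff (U := C_R_NormedModule) (V := R_NormedModule)
    V (locally tau) (fun _ => 0).

Definition attractor_point (F : cubic_form) (tau : C) : Prop :=
  upper_half_plane tau /\ critical_point (V_eff F) tau.

Definition upper_half_space (P : C * R) : Prop := 0 < snd P.

Definition embed_half_plane (tau : C) : C * R := (RtoC (Re tau), Im tau).

Definition log_distance (p : P1C) (P : C * R) : R :=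
  let (t, u) := P in
  match p with
  | Some z => ln ((Cmod (t - z) ^ 2 + u ^ 2) / u)
  | None => ln (1 / u)
  end.

Definition log_distance_sum (alpha beta gamma : P1C) (P : C * R) : R :=
  log_distance alpha P + log_distance beta P + log_distance gamma P.

Definition minimizer (alpha beta gamma : P1C) (P : C * R) : Prop :=
  upper_half_space P /\
  forall P' : C * R, upper_half_space P' ->
    log_distance_sum alpha beta gamma P <= log_distance_sum alpha beta gamma P'.

Definition center_of_mass (alpha beta gamma : P1C) : C * R -> Prop :=
  unique (minimizer alpha beta gamma).

(* Main.v *)
(** At [x + iy], write [F(x + yX, Y) = s X^3 + r X^2 Y + q X Y^2 + p Y^3].  Then
    [y^3 V_eff = 3 p^2 + q^2 + r^2 + 3 s^2], and with [z = X + iY] and the form written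
    as [Re (A z^3 + B z^2 conj z)] the critical point equations become
    [3 A conj B + B^2 = 0].  Hence either [B = 0], which forces a nonnegative
    discriminant, or the form is a rotated multiple of [X (X^2 + 3 Y^2)], whose
    discriminant is negative.  In both cases the unit tangent vectors at [x + iy]
    pointing towards the three roots sum to zero, i.e. make angles of 120 degrees,
    and such a point is the unique minimum of the sum of Busemann functions.
    Uniqueness of the attractor point therefore follows from uniqueness of the
    center of mass.  Existence is by explicit formulas: the root of the Hessian
    covariant for three real roots, and the root of
    [q(f, e) q(X, Y) + 2 k^2 (eX - fY)^2] for
    [F = l (eX - fY) q(X, Y)] with [q = (X - mY)^2 + k^2 Y^2]. *)

Require Import Defs.
From Stdlib Require Import Lra Psatz.

(** * The attractor equations and the balance of the three directions *)

Definition cubic_disc (a b c d : R) : R :=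
  b ^ 2 * c ^ 2 - 4 * a * c ^ 3 - 4 * b ^ 3 * d - 27 * a ^ 2 * d ^ 2
  + 18 * a * b * c * d.

(* [(s, r, q, p)] are the coefficients of the form rescaled to the base point [i]. *)
Definition attractor_equations (p q r s : R) : Prop :=
  3 * p * q + 2 * q * r + 3 * r * s = 0 /\
  9 * p ^ 2 + q ^ 2 = r ^ 2 + 9 * s ^ 2.

(* [u + iv = 4 B] and [(s - q) + i (p - r) = 4 A] in the notation of the header; the second
   case says that the form is [(uX - vY) ((uX - vY)^2 + 3 (vX + uY)^2) / (6 n)]. *)
Lemma attractor_equations_cases p q r s :
  attractor_equations p q r s ->
  let u := q + 3 * s in let v := - (3 * p + r) in let n := u ^ 2 + v ^ 2 in
  (u = 0 /\ v = 0) \/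
  (0 < n /\
   6 * n * s = u * (u ^ 2 + 3 * v ^ 2) /\
   6 * n * r = 3 * v * (u ^ 2 - v ^ 2) /\
   6 * n * q = 3 * u * (u ^ 2 - v ^ 2) /\
   6 * n * p = - v * (v ^ 2 + 3 * u ^ 2)).
Proof.
  intros [E1 E2] u v n.
  destruct (Req_dec n 0) as [h|h]; [left|right].
  { unfold n in h. split; nra. }
  split; [unfold n in *; nra|].
  (* [F1] and [F2] are the real and imaginary parts of [3 A conj B + B^2 = 0], times 16. Multiplying
     by [B] gives [3 A |B|^2 = - B^3], whose parts are [G1] and [G2]; thus [B] determines [A]. *)
  assert (F1 : 3 * ((s - q) * u + (p - r) * v) + u ^ 2 - v ^ 2 = 0)
    by (unfold u, v; lra).
  assert (F2 : 3 * ((p - r) * u - (s - q) * v) + 2 * u * v = 0)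
    by (unfold u, v; lra).
  assert (G1 : 3 * n * (s - q) = - (u ^ 3 - 3 * u * v ^ 2)).
  { replace (3 * n * (s - q)) with (u * (3 * ((s - q) * u + (p - r) * v))
      - v * (3 * ((p - r) * u - (s - q) * v))) by (unfold n; ring).
    replace (3 * ((s - q) * u + (p - r) * v)) with (v ^ 2 - u ^ 2) by lra.
    replace (3 * ((p - r) * u - (s - q) * v)) with (- 2 * u * v) by lra. ring. }
  assert (G2 : 3 * n * (p - r) = - (3 * u ^ 2 * v - v ^ 3)).
  { replace (3 * n * (p - r)) with (v * (3 * ((s - q) * u + (p - r) * v))
      + u * (3 * ((p - r) * u - (s - q) * v))) by (unfold n; ring).
    replace (3 * ((s - q) * u + (p - r) * v)) with (v ^ 2 - u ^ 2) by lra.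
    replace (3 * ((p - r) * u - (s - q) * v)) with (- 2 * u * v) by lra. ring. }
  assert (Hs : s = ((s - q) + u) / 4) by (unfold u; field).
  assert (Hq : q = (u - 3 * (s - q)) / 4) by (unfold u; field).
  assert (Hp : p = ((p - r) - v) / 4) by (unfold v; field).
  assert (Hr : r = (- v - 3 * (p - r)) / 4) by (unfold v; field).
  repeat split.
  - replace (6 * n * s) with ((3 * n * (s - q) + 3 * n * u) / 2)
      by (rewrite Hs at 2; field). rewrite G1. unfold n; field.
  - replace (6 * n * r) with ((- 3 * n * v - 3 * (3 * n * (p - r))) / 2)
      by (rewrite Hr at 2; field). rewrite G2. unfold n; field.
  - replace (6 * n * q) with ((3 * n * u - 3 * (3 * n * (s - q))) / 2)
      by (rewrite Hq at 2; field). rewrite G1. unfold n; field.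
  - replace (6 * n * p) with ((3 * n * (p - r) - 3 * n * v) / 2)
      by (rewrite Hp at 2; field). rewrite G2. unfold n; field.
Qed.

(* [(2eg, g^2 - e^2) / (g^2 + e^2)] is the direction of the real point [g : e] seen from [i]. *)
Lemma balanced_real l g1 e1 g2 e2 g3 e3 p q r s :
  s = l * (e1 * e2 * e3) ->
  r = - l * (g1 * e2 * e3 + e1 * g2 * e3 + e1 * e2 * g3) ->
  q = l * (g1 * g2 * e3 + g1 * e2 * g3 + e1 * g2 * g3) ->
  p = - l * (g1 * g2 * g3) ->
  cubic_disc s r q p <> 0 ->
  attractor_equations p q r s ->
  2 * e1 * g1 / (g1 ^ 2 + e1 ^ 2) + 2 * e2 * g2 / (g2 ^ 2 + e2 ^ 2)
    + 2 * e3 * g3 / (g3 ^ 2 + e3 ^ 2) = 0 /\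
  (g1 ^ 2 - e1 ^ 2) / (g1 ^ 2 + e1 ^ 2) + (g2 ^ 2 - e2 ^ 2) / (g2 ^ 2 + e2 ^ 2)
    + (g3 ^ 2 - e3 ^ 2) / (g3 ^ 2 + e3 ^ 2) = 0.
Proof.
  intros hs hr hq hp hd h.
  assert (D : cubic_disc s r q p = l ^ 4 * ((g1 * e2 - g2 * e1) * (g1 * e3 - g3 * e1)
     * (g2 * e3 - g3 * e2)) ^ 2)
    by (rewrite hs, hr, hq, hp; unfold cubic_disc; ring).
  destruct (attractor_equations_cases _ _ _ _ h) as [[hu hv]|(hn & ks & kr & kq & kp)].
  - assert (hl : l <> 0) by (intros ->; apply hd; rewrite D; ring).
    assert (N1 : g1 ^ 2 + e1 ^ 2 <> 0).
    { intros z. apply hd. rewrite D. assert (g1 = 0) by nra. assert (e1 = 0) by nra. subst g1 e1. ring. }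
    assert (N2 : g2 ^ 2 + e2 ^ 2 <> 0).
    { intros z. apply hd. rewrite D. assert (g2 = 0) by nra. assert (e2 = 0) by nra. subst g2 e2. ring. }
    assert (N3 : g3 ^ 2 + e3 ^ 2 <> 0).
    { intros z. apply hd. rewrite D. assert (g3 = 0) by nra. assert (e3 = 0) by nra. subst g3 e3. ring. }
    (* The sum of the [zeta / conj zeta], [zeta = g + ie], over the common denominator;
       [X + iY] is the product of the [zeta]s. *)
    set (U := q + 3 * s) in *. set (V := 3 * p + r) in *.
    set (X := g1 * g2 * g3 - g1 * e2 * e3 - e1 * g2 * e3 - e1 * e2 * g3).
    set (Y := e1 * g2 * g3 + g1 * e2 * g3 + g1 * g2 * e3 - e1 * e2 * e3).
    assert (hV : V = 0) by lra.
    split.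
    + assert (K : l * (2 * e1 * g1 / (g1 ^ 2 + e1 ^ 2) + 2 * e2 * g2 / (g2 ^ 2 + e2 ^ 2)
    + 2 * e3 * g3 / (g3 ^ 2 + e3 ^ 2)) = - (X * U + Y * V)
        / ((g1 ^ 2 + e1 ^ 2) * (g2 ^ 2 + e2 ^ 2) * (g3 ^ 2 + e3 ^ 2))).
      { unfold U, V, X, Y. rewrite hs, hr, hq, hp. field. auto. }
      rewrite hu, hV in K. apply Rmult_eq_reg_l with l; auto. rewrite K. field. auto.
    + assert (K : l * ((g1 ^ 2 - e1 ^ 2) / (g1 ^ 2 + e1 ^ 2) + (g2 ^ 2 - e2 ^ 2) / (g2 ^ 2 + e2 ^ 2)
    + (g3 ^ 2 - e3 ^ 2) / (g3 ^ 2 + e3 ^ 2)) = (Y * U - X * V)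
        / ((g1 ^ 2 + e1 ^ 2) * (g2 ^ 2 + e2 ^ 2) * (g3 ^ 2 + e3 ^ 2))).
      { unfold U, V, X, Y. rewrite hs, hr, hq, hp. field. auto. }
      rewrite hu, hV in K. apply Rmult_eq_reg_l with l; auto. rewrite K. field. auto.
  - exfalso. set (u := q + 3 * s) in *. set (v := - (3 * p + r)) in *.
    set (n := u ^ 2 + v ^ 2) in *.
    (* The discriminant of [X (X^2 + 3 Y^2)] is [-108], and the substitution by [uX - vY] and
       [vX + uY], of determinant [n], contributes [n^6]. The sign contradicts [D], where three real
       linear factors give a nonnegative discriminant. *)
    assert (K : (6 * n) ^ 4 * cubic_disc s r q p = - 108 * n ^ 6).
    { transitivity (cubic_disc (6 * n * s) (6 * n * r) (6 * n * q) (6 * n * p)).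
      - unfold cubic_disc; ring.
      - rewrite ks, kr, kq, kp. unfold cubic_disc, n. ring. }
    assert (0 < n ^ 6) by (apply pow_lt; auto).
    assert (0 < (6 * n) ^ 4) by (apply pow_lt; lra).
    assert (0 <= cubic_disc s r q p).
    { rewrite D. apply Rmult_le_pos. replace (l ^ 4) with ((l * l) * (l * l)) by ring.
      apply Rle_0_sqr. apply pow2_ge_0. }
    nra.
Qed.

(** Here the form is [l (eX - gY) ((X - mY)^2 + k^2 Y^2)]. Seen from [i], the directions towards
    [m + ik] and [m - ik] agree along the half plane and have opposite normal components, so two
    balance equations remain, with the pair counted twice. *)
Lemma balanced_pair l g e m k p q r s :
  s = l * e ->
  r = - l * (g + 2 * m * e) ->
  q = l * (e * (m ^ 2 + k ^ 2) + 2 * m * g) ->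
  p = - l * (g * (m ^ 2 + k ^ 2)) ->
  cubic_disc s r q p <> 0 ->
  attractor_equations p q r s ->
  2 * e * g / (g ^ 2 + e ^ 2) + 2 * (2 * m / (m ^ 2 + k ^ 2 + 1)) = 0 /\
  (g ^ 2 - e ^ 2) / (g ^ 2 + e ^ 2) + 2 * ((m ^ 2 + k ^ 2 - 1) / (m ^ 2 + k ^ 2 + 1)) = 0.
Proof.
  intros hs hr hq hp hd h.
  assert (D : cubic_disc s r q p = - l ^ 4 * (4 * k ^ 2) * ((g - m * e) ^ 2 + (k * e) ^ 2) ^ 2)
    by (rewrite hs, hr, hq, hp; unfold cubic_disc; ring).
  destruct (attractor_equations_cases _ _ _ _ h) as [[hu hv]|(hn & ks & kr & kq & kp)].
  (* If [B = 0] the discriminant is nonnegative, while [D] makes it minus a square; it would have to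
     vanish. *)
  - exfalso.
    assert (q = - 3 * s) by lra. assert (r = - 3 * p) by lra.
    assert (D' : cubic_disc s r q p = 108 * (s ^ 2 + p ^ 2) ^ 2).
    { rewrite H, H0. unfold cubic_disc; ring. }
    assert (D'' : cubic_disc s r q p = - (l ^ 2 * (2 * k) * ((g - m * e) ^ 2 + (k * e) ^ 2)) ^ 2)
      by (rewrite D; ring).
    assert (X1 := pow2_ge_0 (s ^ 2 + p ^ 2)).
    assert (X2 := pow2_ge_0 (l ^ 2 * (2 * k) * ((g - m * e) ^ 2 + (k * e) ^ 2))). lra.
  - set (u := q + 3 * s) in *. set (v := - (3 * p + r)) in *.
    set (n := u ^ 2 + v ^ 2) in *.
    assert (hl : l <> 0) by (intros ->; apply hd; rewrite D; ring).
    (* The form vanishes at its real root [[g : e]]. Vanishing of the sum of squares in [Z] also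
       forces [ug = ve], so [[g : e]] is the real root [[v : u]] of the rotated form. *)
    assert (hg : u * g = v * e).
    { assert (Z : (u * g - v * e) * ((u * g - v * e) ^ 2 + 3 * (v * g + u * e) ^ 2) = 0).
      { transitivity (6 * n * s * g ^ 3 + 6 * n * r * g ^ 2 * e + 6 * n * q * g * e ^ 2 + 6 * n * p * e ^ 3).
        rewrite ks, kr, kq, kp. ring.
        rewrite hs, hr, hq, hp. ring. }
      apply Rmult_integral in Z. destruct Z as [Z|Z]; [lra|].
      assert (Z1 := pow2_ge_0 (u * g - v * e)). assert (Z2 := pow2_ge_0 (v * g + u * e)).
      assert ((u * g - v * e) ^ 2 = 0) by lra. nra. }
    set (t := (g * v + e * u) / n).
    assert (ht1 : g = t * v). { unfold t. apply Rmult_eq_reg_l with n; [|lra].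
      replace (n * ((g * v + e * u) / n * v)) with (g * v ^ 2 + u * (v * e)) by (field; lra).
      rewrite <- hg. unfold n. ring. }
    assert (ht2 : e = t * u). { unfold t. apply Rmult_eq_reg_l with n; [|lra].
      replace (n * ((g * v + e * u) / n * u)) with (v * (u * g) + e * u ^ 2) by (field; lra).
      rewrite hg. unfold n. ring. }
    set (w := 6 * n * l * t).
    (* [c3], [c2], [c1], [c0] say that [uX - vY] times [d2 X^2 + d1 X Y + d0 Y^2] is zero, where the
       quadratic is the difference of [w ((X - mY)^2 + k^2 Y^2)] and [(uX - vY)^2 + 3 (vX + uY)^2].
       As [u] and [v] are not both zero, the quadratic vanishes, which determines [m] and
       [m^2 + k^2]. *)
    assert (c3 : u * (w - (u ^ 2 + 3 * v ^ 2)) = 0).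
    { transitivity (6 * n * (l * e) - u * (u ^ 2 + 3 * v ^ 2)).
      unfold w; rewrite ht2; ring. rewrite <- hs; lra. }
    assert (c0 : v * (w * (m ^ 2 + k ^ 2) - (v ^ 2 + 3 * u ^ 2)) = 0).
    { transitivity (- (6 * n * (- l * (g * (m ^ 2 + k ^ 2)))) - v * (v ^ 2 + 3 * u ^ 2)).
      unfold w; rewrite ht1; ring. rewrite <- hp; lra. }
    assert (c2 : u * (-2 * m * w - 4 * u * v) = v * (w - (u ^ 2 + 3 * v ^ 2))).
    { apply Rminus_diag_uniq.
      transitivity (6 * n * (- l * (g + 2 * m * e)) - 3 * v * (u ^ 2 - v ^ 2)).
      unfold w; rewrite ht1, ht2; ring. rewrite <- hr; lra. }
    assert (c1 : u * (w * (m ^ 2 + k ^ 2) - (v ^ 2 + 3 * u ^ 2)) = v * (-2 * m * w - 4 * u * v)).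
    { apply Rminus_diag_uniq.
      transitivity (6 * n * (l * (e * (m ^ 2 + k ^ 2) + 2 * m * g)) - 3 * u * (u ^ 2 - v ^ 2)).
      unfold w; rewrite ht1, ht2; ring. rewrite <- hq; lra. }
    set (d2 := w - (u ^ 2 + 3 * v ^ 2)) in *.
    set (d1 := -2 * m * w - 4 * u * v) in *.
    set (d0 := w * (m ^ 2 + k ^ 2) - (v ^ 2 + 3 * u ^ 2)) in *.
    assert (H : d2 = 0 /\ d1 = 0 /\ d0 = 0).
    { destruct (Req_dec u 0) as [u0|u0].
      - assert (v <> 0) by (intros v0; unfold n in hn; rewrite u0, v0 in hn; lra).
        rewrite u0, ?Rmult_0_l in *.
        assert (d0 = 0) by (apply Rmult_integral in c0; tauto).
        symmetry in c1, c2. apply Rmult_integral in c1, c2. tauto.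
      - apply Rmult_integral in c3. destruct c3 as [|z2]; [tauto|].
        rewrite z2, Rmult_0_r in c2. apply Rmult_integral in c2. destruct c2 as [|z1]; [tauto|].
        rewrite z1, Rmult_0_r in c1. apply Rmult_integral in c1. tauto. }
    destruct H as (z2 & z1 & z0).
    assert (ht : t <> 0). { intros z. apply hd. rewrite D, ht1, ht2, z. ring. }
    assert (hw : w <> 0).
    { assert (6 * n <> 0) by lra. unfold w. auto using Rmult_integral_contrapositive_currified. }
    assert (hm : m = - 2 * u * v / w).
    { replace (- 2 * u * v) with (m * w) by (unfold d1 in z1; lra). field; auto. }
    assert (hM : m ^ 2 + k ^ 2 = (v ^ 2 + 3 * u ^ 2) / w).
    { replace (v ^ 2 + 3 * u ^ 2) with ((m ^ 2 + k ^ 2) * w) by (unfold d0 in z0; lra).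
      field; auto. }
    assert (W : w = u ^ 2 + 3 * v ^ 2) by (unfold d2 in z2; lra).
    rewrite hM, hm, W, ht1, ht2 in *. unfold n in hn.
    assert ((t * v) ^ 2 + (t * u) ^ 2 <> 0).
    { replace ((t * v) ^ 2 + (t * u) ^ 2) with (t ^ 2 * (u ^ 2 + v ^ 2)) by ring.
      apply Rmult_integral_contrapositive_currified; [apply pow_nonzero; auto|lra]. }
    assert (v ^ 2 + 3 * u ^ 2 + (u ^ 2 + 3 * v ^ 2) <> 0) by lra.
    split; field; auto.
Qed.

(** * Explicit attractor points *)

Definition attractor_at (a b c d x y : R) : Prop :=
  attractor_equations (a * x ^ 3 + b * x ^ 2 + c * x + d)
    ((3 * a * x ^ 2 + 2 * b * x + c) * y) ((3 * a * x + b) * y ^ 2) (a * y ^ 3).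

(** The witness is the root of the Hessian [h X^2 + (bc - 9ad) X Y + (c^2 - 3bd) Y^2], whose
    discriminant is [-3] times that of the cubic. There [h1] and [h2] express [B = 0], which solves
    both attractor equations. *)
Lemma attractor_exists_pos a b c d :
  0 < cubic_disc a b c d -> exists x y, 0 < y /\ attractor_at a b c d x y.
Proof.
  intros hd.
  set (h := b ^ 2 - 3 * a * c).
  assert (hh : 0 < h).
  { destruct (Req_dec a 0) as [a0|a0].
    - unfold h. destruct (Req_dec b 0) as [b0|b0]; [|rewrite a0; nra].
      revert hd; rewrite a0, b0; unfold cubic_disc; intros; lra.
    (* This is the syzygy [4 H^3 = 27 disc f^2 + G^2] between a cubic [f], its Hessian [H] and its
       cubic covariant [G], read off at the leading coefficients. *)
    - assert (K : 4 * h ^ 3 = 27 * a ^ 2 * cubic_disc a b c d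
        + (2 * b ^ 3 - 9 * a * b * c + 27 * a ^ 2 * d) ^ 2)
        by (unfold h, cubic_disc; ring).
      assert (0 < a ^ 2) by (apply pow2_gt_0; auto).
      assert (0 <= (2 * b ^ 3 - 9 * a * b * c + 27 * a ^ 2 * d) ^ 2) by apply pow2_ge_0.
      assert (0 < a ^ 2 * cubic_disc a b c d) by (apply Rmult_lt_0_compat; auto).
      destruct (Rlt_or_le 0 h) as [|g]; auto.
      assert (0 <= h ^ 2) by apply pow2_ge_0.
      assert (h ^ 3 <= 0) by (replace (h ^ 3) with (h * h ^ 2) by ring; nra). lra. }
  set (x := - (b * c - 9 * a * d) / (2 * h)).
  set (y := sqrt (3 * cubic_disc a b c d) / (2 * h)).
  assert (hy2 : y ^ 2 = 3 * cubic_disc a b c d / (4 * h ^ 2)).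
  { unfold y, Rdiv. rewrite Rpow_mult_distr, pow2_sqrt by lra. field; lra. }
  exists x, y. split.
  { unfold y. apply Rdiv_lt_0_compat; [apply sqrt_lt_R0|]; lra. }
  assert (h1 : 3 * a * x ^ 2 + 2 * b * x + c = - 3 * a * y ^ 2).
  { rewrite hy2. unfold x, cubic_disc, h. field. fold h; lra. }
  assert (h2 : (3 * a * x + b) * y ^ 2 = - 3 * (a * x ^ 3 + b * x ^ 2 + c * x + d)).
  { rewrite hy2. unfold x, cubic_disc, h. field. fold h; lra. }
  unfold attractor_at, attractor_equations. rewrite h2, h1. split; ring.
Qed.

Lemma attractor_exists_pair l f e m k :
  cubic_disc (l * e) (- l * (f + 2 * m * e))
    (l * (e * (m ^ 2 + k ^ 2) + 2 * m * f)) (- l * (f * (m ^ 2 + k ^ 2))) <> 0 ->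
  exists x y, 0 < y /\
  attractor_at (l * e) (- l * (f + 2 * m * e))
    (l * (e * (m ^ 2 + k ^ 2) + 2 * m * f)) (- l * (f * (m ^ 2 + k ^ 2))) x y.
Proof.
  intros hd.
  (* [n] is [q(f, e)], and [j] is the leading coefficient of the quadratic form given in the header.
     That form has discriminant [-12 k^2 n^2], which yields [x] and [y]. *)
  set (n := (f - m * e) ^ 2 + (k * e) ^ 2).
  match type of hd with ?D <> 0 =>
    assert (E : D = - l ^ 4 * (4 * k ^ 2) * n ^ 2) by (unfold cubic_disc, n; ring) end.
  assert (hk : k <> 0) by (intros z; apply hd; rewrite E, z; ring).
  assert (hn : 0 < n).
  { assert (n <> 0) by (intros z; apply hd; rewrite E, z; ring).
    assert (0 <= n) by (apply Rplus_le_le_0_compat; apply pow2_ge_0). lra. }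
  set (j := n + 2 * k ^ 2 * e ^ 2).
  assert (hj : 0 < j) by (unfold j; assert (0 <= (k * e) ^ 2) by apply pow2_ge_0; nra).
  set (x := (m * n + 2 * k ^ 2 * e * f) / j).
  set (y := sqrt 3 * Rabs k * n / j).
  assert (hy2 : y ^ 2 = 3 * k ^ 2 * n ^ 2 / j ^ 2).
  { unfold y, Rdiv. rewrite !Rpow_mult_distr, pow2_sqrt, pow2_abs by lra.
    field; lra. }
  exists x, y. split.
  { unfold y. apply Rdiv_lt_0_compat; auto. repeat apply Rmult_lt_0_compat; auto.
    apply sqrt_lt_R0; lra. apply Rabs_pos_lt; auto. }
  unfold attractor_at, attractor_equations. split.
  (* Both equations are regrouped so that, up to an overall factor [y], only powers of [y^2] occur
     and [hy2] eliminates the square root. *)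
  - match goal with |- ?L = 0 =>
    match L with 3 * ?p * (?q * y) + 2 * (?q * y) * (?r * y ^ 2) + 3 * (?r * y ^ 2) * (?s * y ^ 3) =>
    replace L with (y * (3 * p * q + 2 * q * r * y ^ 2 + 3 * r * s * (y ^ 2) ^ 2)) by ring end end.
    rewrite hy2. unfold x, j, n. field. fold n. fold j. lra.
  - match goal with |- 9 * ?p ^ 2 + (?q * y) ^ 2 = (?r * y ^ 2) ^ 2 + 9 * (?s * y ^ 3) ^ 2 =>
    replace ((q * y) ^ 2) with (q ^ 2 * y ^ 2) by ring;
    replace ((s * y ^ 3) ^ 2) with (s ^ 2 * (y ^ 2) ^ 3) by ring end.
    rewrite hy2. unfold x, j, n. field. fold n. fold j. lra.
Qed.

(** * Balanced points are centers of mass *)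

(** Unit vectors summing to zero meet at 120 degrees. If their inner products with [v] are [x], [y],
    [- x - y], the product is [c^3 - c q + x y (x + y)]. For given length [s] of [v] it is smallest
    when [v] points along one of the three vectors, with value [(c - s) (c + s/2)^2]. *)
Lemma balanced_product_bound c v1 v2 v3 a1 a2 a3 b1 b2 b3 c1 c2 c3 :
  0 < c -> c ^ 2 = 1 + v1 ^ 2 + v2 ^ 2 + v3 ^ 2 ->
  a1 ^ 2 + a2 ^ 2 + a3 ^ 2 = 1 ->
  b1 ^ 2 + b2 ^ 2 + b3 ^ 2 = 1 ->
  c1 ^ 2 + c2 ^ 2 + c3 ^ 2 = 1 ->
  a1 + b1 + c1 = 0 -> a2 + b2 + c2 = 0 -> a3 + b3 + c3 = 0 ->
  let D := (c - (v1 * a1 + v2 * a2 + v3 * a3)) * (c - (v1 * b1 + v2 * b2 + v3 * b3))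
     * (c - (v1 * c1 + v2 * c2 + v3 * c3)) in
  1 <= D /\ (D <= 1 -> c = 1).
Proof.
  intros hc hv ha hb hcc s1 s2 s3 D.
  assert (hab : a1 * b1 + a2 * b2 + a3 * b3 = - / 2).
  { replace c1 with (- a1 - b1) in hcc by lra. replace c2 with (- a2 - b2) in hcc by lra.
    replace c3 with (- a3 - b3) in hcc by lra. lra. }
  set (x := v1 * a1 + v2 * a2 + v3 * a3) in *.
  set (y := v1 * b1 + v2 * b2 + v3 * b3) in *.
  assert (hz : v1 * c1 + v2 * c2 + v3 * c3 = - x - y).
  { replace c1 with (- a1 - b1) by lra. replace c2 with (- a2 - b2) by lra.
    replace c3 with (- a3 - b3) by lra. unfold x, y. ring. }
  set (V := v1 ^ 2 + v2 ^ 2 + v3 ^ 2).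
  set (q := x ^ 2 + x * y + y ^ 2).
  (* Bessel's inequality for the projection of [v] to the plane of the three directions *)
  assert (hq : 4 * q <= 3 * V).
  { set (p := 4 / 3 * x + 2 / 3 * y). set (r := 2 / 3 * x + 4 / 3 * y).
    assert (K : (v1 - p * a1 - r * b1) ^ 2 + (v2 - p * a2 - r * b2) ^ 2 + (v3 - p * a3 - r * b3) ^ 2
      = V - 2 * p * x - 2 * r * y + p ^ 2 * (a1 ^ 2 + a2 ^ 2 + a3 ^ 2)
        + r ^ 2 * (b1 ^ 2 + b2 ^ 2 + b3 ^ 2) + 2 * p * r * (a1 * b1 + a2 * b2 + a3 * b3))
      by (unfold V, x, y; ring).
    rewrite ha, hb, hab in K.
    assert (K1 := pow2_ge_0 (v1 - p * a1 - r * b1)).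
    assert (K2 := pow2_ge_0 (v2 - p * a2 - r * b2)).
    assert (K3 := pow2_ge_0 (v3 - p * a3 - r * b3)).
    unfold p, r, q in *. lra. }
  assert (hV : 0 <= V) by (unfold V; assert (K1 := pow2_ge_0 v1);
    assert (K2 := pow2_ge_0 v2); assert (K3 := pow2_ge_0 v3); lra).
  assert (hq0 : 0 <= q).
  { unfold q. assert (K1 := pow2_ge_0 (x + y)). assert (K2 := pow2_ge_0 x).
    assert (K3 := pow2_ge_0 y). lra. }
  set (k := sqrt (q / 3)). set (s := sqrt V).
  assert (hk : k ^ 2 = q / 3) by (apply pow2_sqrt; lra).
  assert (hs : s ^ 2 = V) by (apply pow2_sqrt; lra).
  assert (k0 : 0 <= k) by apply sqrt_pos.
  assert (s0 : 0 <= s) by apply sqrt_pos.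
  assert (hks : 2 * k <= s).
  { apply Rsqr_incr_0; [unfold Rsqr|..]; lra. }
  assert (he : - (2 * k ^ 3) <= x * y * (x + y)).
  { assert (K : (x * y * (x + y)) ^ 2 <= (2 * k ^ 3) ^ 2).
    { replace ((2 * k ^ 3) ^ 2) with (4 * (k ^ 2) ^ 3) by ring. rewrite hk.
      (* discriminant of the cubic with roots [x], [y], [- x - y] *)
      assert (K := pow2_ge_0 ((x - y) * (2 * x + y) * (x + 2 * y))).
      unfold q in *. lra. }
    assert (0 <= k ^ 3) by (apply pow_le; auto).
    apply Rsqr_neg_pos_le_0 with (y := 2 * k ^ 3); [unfold Rsqr; lra|lra]. }
  assert (hD : D = c ^ 3 - c * (3 * k ^ 2) + x * y * (x + y)).
  { unfold D. rewrite hz, hk. unfold q. field. }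
  assert (hcs : (c - s) * (c + s) = 1).
  { replace ((c - s) * (c + s)) with (c ^ 2 - s ^ 2) by ring. rewrite hv, hs. unfold V. ring. }
  (* [c = cosh rho], [s = sinh rho], [w = exp rho] *)
  set (w := c + s) in *.
  assert (hw : 1 <= w). { unfold w. nra. }
  (* The lower bound [c^3 - 3 c k^2 - 2 k^3] decreases in [k], so [k] may be replaced by its maximum
     [s / 2]. *)
  assert (hD2 : (c - s) * (c + s / 2) ^ 2 <= D).
  { assert (c ^ 3 - 3 * c * k ^ 2 - 2 * k ^ 3 <= D) by (rewrite hD; lra).
    assert ((c - s) * (c + s / 2) ^ 2 <= c ^ 3 - 3 * c * k ^ 2 - 2 * k ^ 3).
    { apply Rminus_le_0.
      replace (c ^ 3 - 3 * c * k ^ 2 - 2 * k ^ 3 - (c - s) * (c + s / 2) ^ 2) with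
       (3 * c * (s / 2 - k) * (s / 2 + k) + 2 * ((s/2) - k) * ((s/2) ^ 2 + s / 2 * k + k ^ 2)) by field.
      assert (0 <= s / 2 - k) by lra. assert (0 <= s / 2 + k) by lra.
      assert (0 <= (s/2) ^ 2 + s / 2 * k + k ^ 2) by nra.
      assert (0 <= (s / 2 - k) * (s / 2 + k)) by (apply Rmult_le_pos; auto).
      assert (0 <= (s / 2 - k) * ((s/2) ^ 2 + s / 2 * k + k ^ 2)) by (apply Rmult_le_pos; auto).
      nra. }
    lra. }
  assert (hcw : c - s = / w) by (apply Rmult_eq_reg_r with w; [rewrite hcs; field|]; lra).
  assert (hc2 : c + s / 2 = (3 * w + / w) / 4) by (rewrite <- hcw; unfold w; field).
  (* The excess over 1 has a double zero at [w = 1] and a positive cofactor, which gives both the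
     bound and the equality case. *)
  assert (hf : (c - s) * (c + s / 2) ^ 2 - 1 = (w - 1) ^ 2 * (9 * w ^ 2 + 2 * w + 1) / (16 * w ^ 3)).
  { rewrite hcw, hc2. field. lra. }
  assert (h9 : 0 < (9 * w ^ 2 + 2 * w + 1) / (16 * w ^ 3)).
  { apply Rdiv_lt_0_compat; [nra|]. assert (0 < w ^ 3) by (apply pow_lt; lra). lra. }
  unfold Rdiv in hf. rewrite Rmult_assoc in hf. fold (Rdiv (9 * w ^ 2 + 2 * w + 1) (16 * w ^ 3)) in hf.
  assert (h10 := pow2_ge_0 (w - 1)).
  split; [nra|].
  intros h1. assert ((w - 1) ^ 2 = 0) by nra. assert (w = 1) by nra.
  assert (/ w = 1) by (rewrite H0; apply Rinv_1). unfold w in *; lra.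
Qed.

(* The unit tangent vector at [P] of the geodesic towards [p]. *)
Definition ideal_direction (P : C * R) (p : P1C) : R * R * R :=
  let (t, u) := P in
  match p with
  | Some z =>
      let n := Cmod (z - t) ^ 2 + u ^ 2 in
      (2 * u * Re (z - t) / n, 2 * u * Im (z - t) / n, (Cmod (z - t) ^ 2 - u ^ 2) / n)
  | None => (0, 0, 1)
  end.

Lemma Cmod_sqr (z : C) : Cmod z ^ 2 = Re z ^ 2 + Im z ^ 2.
Proof. unfold Cmod. apply pow2_sqrt. nra. Qed.

Lemma sum_squares_pos x y u : 0 < u -> 0 < x ^ 2 + y ^ 2 + u ^ 2.
Proof.
  intros hu. assert (hx := pow2_ge_0 x). assert (hy := pow2_ge_0 y).
  assert (h := pow_lt u 2 hu). lra.
Qed.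

Lemma ideal_direction_unit P p :
  0 < snd P ->
  let '(n1, n2, n3) := ideal_direction P p in n1 ^ 2 + n2 ^ 2 + n3 ^ 2 = 1.
Proof.
  destruct P as [t u], p as [z|]; simpl snd; intros hu; [|simpl; ring].
  unfold ideal_direction. rewrite Cmod_sqr. field.
  apply Rgt_not_eq, sum_squares_pos; auto.
Qed.

(* [(c, v1, v2, v3)] are the hyperboloid coordinates of [P'] centred at [P]. *)
Lemma log_distance_ideal_direction P P' p :
  0 < snd P -> 0 < snd P' ->
  let '(n1, n2, n3) := ideal_direction P p in
  let c := (Cmod (fst P' - fst P) ^ 2 + snd P' ^ 2 + snd P ^ 2) / (2 * snd P * snd P') in
  let v1 := Re (fst P' - fst P) / snd P' in
  let v2 := Im (fst P' - fst P) / snd P' in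
  let v3 := (Cmod (fst P' - fst P) ^ 2 + snd P' ^ 2 - snd P ^ 2) / (2 * snd P * snd P') in
  let d := c - (v1 * n1 + v2 * n2 + v3 * n3) in
  0 < d /\ log_distance p P' = log_distance p P + ln d.
Proof.
  destruct P as [[t1 t2] u], P' as [[t1' t2'] u']; simpl fst; simpl snd.
  intros hu hu'.
  destruct p as [[z1 z2]|]; unfold ideal_direction, log_distance; cbv zeta; rewrite !Cmod_sqr;
  unfold Cminus, Cplus, Copp, Re, Im; simpl fst; simpl snd.
  - set (n := (z1 + - t1) ^ 2 + (z2 + - t2) ^ 2).
    assert (hn : 0 < n + u ^ 2) by (apply sum_squares_pos; auto).
    assert (hn' : 0 < ((t1' + - z1) ^ 2 + (t2' + - z2) ^ 2 + u' ^ 2)) by (apply sum_squares_pos; auto).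
    (* [d] is the quotient of the arguments of the two logarithms, hence positive. *)
    match goal with |- 0 < ?d /\ _ => assert (E : d =
     (((t1' + - z1) ^ 2 + (t2' + - z2) ^ 2 + u' ^ 2) / u') /
     ((((t1 + - z1) ^ 2 + (t2 + - z2) ^ 2 + u ^ 2) / u))) end.
    { unfold n in *. field. repeat split; lra. }
    rewrite E.
    assert (hn'' : 0 < ((t1 + - z1) ^ 2 + (t2 + - z2) ^ 2 + u ^ 2)) by (apply sum_squares_pos; auto).
    split; [repeat apply Rdiv_lt_0_compat; auto|].
    rewrite <- ln_mult; try (repeat apply Rdiv_lt_0_compat; auto).
    f_equal. field. lra.
  - match goal with |- 0 < ?d /\ _ => assert (E : d = (1 / u') / (1 / u)) end.
    { field. lra. }
    rewrite E. split; [repeat apply Rdiv_lt_0_compat; lra|].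
    rewrite <- ln_mult; try (repeat apply Rdiv_lt_0_compat; lra).
    f_equal. field. lra.
Qed.

Definition balanced (alpha beta gamma : P1C) (P : C * R) : Prop :=
  let '(a1, a2, a3) := ideal_direction P alpha in
  let '(b1, b2, b3) := ideal_direction P beta in
  let '(c1, c2, c3) := ideal_direction P gamma in
  a1 + b1 + c1 = 0 /\ a2 + b2 + c2 = 0 /\ a3 + b3 + c3 = 0.

(** From [P] to [P'] the sum changes by the logarithm of the product in [balanced_product_bound].
    Its equality case [c = 1] says that the hyperbolic distance from [P] to [P'] is zero. *)
Lemma balanced_center_of_mass alpha beta gamma P :
  0 < snd P -> balanced alpha beta gamma P -> center_of_mass alpha beta gamma P.
Proof.
  intros hu hbal.
  assert (main : forall P', 0 < snd P' ->
    log_distance_sum alpha beta gamma P <= log_distance_sum alpha beta gamma P' /\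
    (log_distance_sum alpha beta gamma P' <= log_distance_sum alpha beta gamma P -> P = P')).
  { intros P' hu'. unfold balanced in hbal.
    assert (La := log_distance_ideal_direction P P' alpha hu hu').
    assert (Lb := log_distance_ideal_direction P P' beta hu hu').
    assert (Lc := log_distance_ideal_direction P P' gamma hu hu').
    assert (Ua := ideal_direction_unit P alpha hu).
    assert (Ub := ideal_direction_unit P beta hu).
    assert (Uc := ideal_direction_unit P gamma hu).
    destruct (ideal_direction P alpha) as [[a1 a2] a3].
    destruct (ideal_direction P beta) as [[b1 b2] b3].
    destruct (ideal_direction P gamma) as [[c1 c2] c3].
    destruct hbal as (s1 & s2 & s3).
    cbv zeta in La, Lb, Lc.
    set (c := (Cmod (fst P' - fst P) ^ 2 + snd P' ^ 2 + snd P ^ 2) / (2 * snd P * snd P')) in *.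
    set (v1 := Re (fst P' - fst P) / snd P') in *.
    set (v2 := Im (fst P' - fst P) / snd P') in *.
    set (v3 := (Cmod (fst P' - fst P) ^ 2 + snd P' ^ 2 - snd P ^ 2) / (2 * snd P * snd P')) in *.
    destruct La as [La0 La], Lb as [Lb0 Lb], Lc as [Lc0 Lc].
    assert (hc : 0 < c).
    { unfold c. apply Rdiv_lt_0_compat; [|nra].
      assert (K := pow2_ge_0 (Cmod (fst P' - fst P))). nra. }
    assert (hcv : c ^ 2 = 1 + v1 ^ 2 + v2 ^ 2 + v3 ^ 2).
    { unfold c, v1, v2, v3. rewrite Cmod_sqr. field. lra. }
    destruct (balanced_product_bound c v1 v2 v3 a1 a2 a3 b1 b2 b3 c1 c2 c3) as [K1 K2]; auto.
    set (da := c - (v1 * a1 + v2 * a2 + v3 * a3)) in *.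
    set (db := c - (v1 * b1 + v2 * b2 + v3 * b3)) in *.
    set (dc := c - (v1 * c1 + v2 * c2 + v3 * c3)) in *.
    assert (L : log_distance_sum alpha beta gamma P' =
      log_distance_sum alpha beta gamma P + ln (da * db * dc)).
    { unfold log_distance_sum. rewrite La, Lb, Lc, !ln_mult; auto. ring.
      apply Rmult_lt_0_compat; auto. }
    rewrite L. split.
    - assert (0 <= ln (da * db * dc)); [|lra].
      rewrite <- ln_1. apply ln_le; lra.
    - intros hle. assert (hc1 : c = 1).
      { apply K2. apply Rnot_lt_le. intros hlt. apply ln_increasing in hlt; [|lra].
        rewrite ln_1 in hlt. lra. }
      (* The squared Euclidean distance of the two points is [c - 1] times twice the product of
         their heights. *)
      assert (E : Re (fst P' - fst P) ^ 2 + Im (fst P' - fst P) ^ 2 + (snd P' - snd P) ^ 2 = 0).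
      { rewrite <- Cmod_sqr. transitivity (2 * snd P * snd P' * (c - 1)).
        unfold c; field; lra. rewrite hc1; ring. }
      destruct P as [[t1 t2] u], P' as [[t1' t2'] u'].
      unfold Cminus, Cplus, Copp, Re, Im in E; simpl fst in E; simpl snd in E.
      assert (X1 := pow2_ge_0 (t1' + - t1)). assert (X2 := pow2_ge_0 (t2' + - t2)).
      assert (X3 := pow2_ge_0 (u' - u)).
      repeat f_equal; apply Rminus_diag_uniq_sym, Rsqr_0_uniq; unfold Rsqr; lra. }
  split.
  - split; [exact hu|]. intros P' hu'. apply main; exact hu'.
  - intros P' [hu' hmin]. apply main; auto.
Qed.

(** * The effective potential in real coordinates and its critical points *)

Definition real_coefs (F : cubic_form) : R * R * R * R :=
  (Q2R (coef_a F), Q2R (coef_b F), Q2R (coef_c F), Q2R (coef_d F)).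

Lemma central_charge_xy F x y :
  let '(a, b, c, d) := real_coefs F in
  central_charge F (x, y) =
  (a * x ^ 3 + b * x ^ 2 + c * x + d - (3 * a * x + b) * y ^ 2,
   (3 * a * x ^ 2 + 2 * b * x + c) * y - a * y ^ 3).
Proof.
  destruct F as [a b c d]. unfold real_coefs, central_charge, eval_form; simpl coef_a; simpl coef_b;
  simpl coef_c; simpl coef_d.
  unfold Cpow, RtoC, Cmult, Cplus; apply injective_projections; simpl fst; simpl snd; ring.
Qed.

(** The four partial derivatives satisfy the Cauchy-Riemann equations, so the result is the complex
    derivative [3 a tau^2 + 2 b tau + c]. *)
Lemma d_tau_central_charge F x y :
  let '(a, b, c, d) := real_coefs F in
  d_tau (central_charge F) (x, y) =
  (3 * a * x ^ 2 + 2 * b * x + c - 3 * a * y ^ 2, 2 * (3 * a * x + b) * y).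
Proof.
  assert (H := central_charge_xy F).
  destruct (real_coefs F) as [[[a b] c] d].
  unfold d_tau, partial_x, partial_y; unfold Re, Im; simpl fst; simpl snd.
  rewrite (Derive_ext _ (fun x => a * x ^ 3 + b * x ^ 2 + c * x + d - (3 * a * x + b) * y ^ 2));
    [|intros; rewrite H; reflexivity].
  rewrite (Derive_ext (fun x => snd _) (fun x => (3 * a * x ^ 2 + 2 * b * x + c) * y - a * y ^ 3));
    [|intros; rewrite H; reflexivity].
  rewrite (Derive_ext (fun y => fst _) (fun y => a * x ^ 3 + b * x ^ 2 + c * x + d - (3 * a * x + b) * y ^ 2));
    [|intros; rewrite H; reflexivity].
  rewrite (Derive_ext (fun y => snd _) (fun y => (3 * a * x ^ 2 + 2 * b * x + c) * y - a * y ^ 3));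
    [|intros; rewrite H; reflexivity].
  rewrite (is_derive_unique _ x (3 * a * x ^ 2 + 2 * b * x + c - 3 * a * y ^ 2));
    [|auto_derive; [trivial|ring]].
  rewrite (is_derive_unique _ x (2 * (3 * a * x + b) * y));
    [|auto_derive; [trivial|ring]].
  rewrite (is_derive_unique _ y (- 2 * (3 * a * x + b) * y));
    [|auto_derive; [trivial|ring]].
  rewrite (is_derive_unique _ y (3 * a * x ^ 2 + 2 * b * x + c - 3 * a * y ^ 2));
    [|auto_derive; [trivial|ring]].
  unfold Cdiv, Cinv, Ci, Cminus, Cmult, Cplus, Copp, RtoC.
  apply injective_projections; simpl fst; simpl snd; field.
Qed.

Lemma partial_x_kahler_potential x y :
  partial_x (fun s => RtoC (kahler_potential s)) (x, y) = 0.
Proof.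
  unfold partial_x, kahler_potential, RtoC, Re, Im; simpl fst; simpl snd.
  now rewrite !Derive_const.
Qed.

Lemma partial_y_kahler_potential x y : 0 < y ->
  partial_y (fun s => RtoC (kahler_potential s)) (x, y) = RtoC (- 3 / y).
Proof.
  intros hy. unfold partial_y, kahler_potential, RtoC, Re, Im; simpl fst; simpl snd.
  rewrite Derive_const. f_equal. apply is_derive_unique.
  auto_derive.
  - assert (0 < y ^ 3) by (apply pow_lt; auto). simpl in H. lra.
  - field. lra.
Qed.

Lemma d_tau_kahler_potential x y : 0 < y ->
  d_tau (fun s => RtoC (kahler_potential s)) (x, y) = (0, 3 / (2 * y)).
Proof.
  intros hy. unfold d_tau. rewrite partial_x_kahler_potential, partial_y_kahler_potential by auto.
  unfold Cdiv, Cinv, Ci, Cminus, Cmult, Cplus, Copp, RtoC.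
  apply injective_projections; simpl fst; simpl snd; field; lra.
Qed.

Lemma d_taubar_kahler_potential x y : 0 < y ->
  d_taubar (fun s => RtoC (kahler_potential s)) (x, y) = (0, - 3 / (2 * y)).
Proof.
  intros hy. unfold d_taubar. rewrite partial_x_kahler_potential, partial_y_kahler_potential by auto.
  unfold Cdiv, Cinv, Ci, Cminus, Cmult, Cplus, Copp, RtoC.
  apply injective_projections; simpl fst; simpl snd; field; lra.
Qed.

Lemma kahler_metric_xy x y : 0 < y -> kahler_metric (x, y) = 3 / (4 * y ^ 2).
Proof.
  intros hy.
  assert (hloc : locally y (fun v => 0 < v)) by (apply open_gt; auto).
  unfold kahler_metric, d_tau, partial_x, partial_y.
  set (g := d_taubar _).
  rewrite (Derive_ext (fun x0 => Re (g (x0, Im (x, y)))) (fun _ => 0));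
    [|intros; unfold g; rewrite d_taubar_kahler_potential by auto; reflexivity].
  rewrite (Derive_ext (fun x0 => Im (g (x0, Im (x, y)))) (fun _ => - 3 / (2 * y)));
    [|intros; unfold g; rewrite d_taubar_kahler_potential by auto; reflexivity].
  rewrite !Derive_const.
  (* The formula for [d_taubar] requires a positive imaginary part: it holds on the whole horizontal
     line, but on the vertical one only near the point. *)
  rewrite (Derive_ext_loc (fun y0 => Re (g (Re (x, y), y0))) (fun _ => 0));
    [|revert hloc; apply filter_imp; intros; unfold g; rewrite d_taubar_kahler_potential by auto; reflexivity].
  rewrite (Derive_ext_loc (fun y0 => Im (g (Re (x, y), y0))) (fun y => - 3 / (2 * y)));
    [|revert hloc; apply filter_imp; intros; unfold g; rewrite d_taubar_kahler_potential by auto; reflexivity].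
  rewrite Derive_const.
  rewrite (is_derive_unique _ _ (3 / (2 * y ^ 2)));
    [|unfold Im; simpl snd; auto_derive; [lra|field; lra]].
  unfold Cdiv, Cinv, Ci, Cminus, Cmult, Cplus, Copp, RtoC, Re; simpl fst; simpl snd; field; lra.
Qed.

Definition potential (a b c d x y : R) : R :=
  3 * (a * x ^ 3 + b * x ^ 2 + c * x + d) ^ 2 / y ^ 3
  + (3 * a * x ^ 2 + 2 * b * x + c) ^ 2 / y
  + (3 * a * x + b) ^ 2 * y + 3 * a ^ 2 * y ^ 3.

(** In the notation of the header, [Z = (p - r) + i (q - s)] and [y DZ = - 2 B]; the cross terms in
    [pr] and [qs] cancel between the two squared moduli. In particular [B = 0] means [DZ = 0]. *)
Lemma V_eff_xy F x y : 0 < y ->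
  let '(a, b, c, d) := real_coefs F in
  V_eff F (x, y) = potential a b c d x y.
Proof.
  intros hy. assert (H := central_charge_xy F x y). assert (H' := d_tau_central_charge F x y).
  destruct (real_coefs F) as [[[a b] c] d].
  unfold V_eff, D_central_charge.
  rewrite kahler_metric_xy, d_tau_kahler_potential, H, H', !Cmod_sqr by auto.
  unfold kahler_potential. assert (0 < y ^ 3) by (apply pow_lt; auto).
  rewrite exp_Ropp, exp_ln; unfold Im; simpl snd; [|lra].
  unfold Cmult, Cplus, Re, Im, potential; simpl fst; simpl snd. field. lra.
Qed.

(** Differentiability follows from a partial derivative in [x] that exists near the point and is
    continuous at it, together with the partial derivative in [y] at the point. *)
Lemma potential_filterdiff a b c d x y : 0 < y ->
  let p := a * x ^ 3 + b * x ^ 2 + c * x + d in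
  let q := 3 * a * x ^ 2 + 2 * b * x + c in
  let r := 3 * a * x + b in
  filterdiff (U := C_R_NormedModule) (V := R_NormedModule)
    (fun t => potential a b c d (Re t) (Im t)) (locally (T := C_UniformSpace) (x, y))
    (fun t => Re t * (2 * (3 * p * q + 2 * q * r * y ^ 2 + 3 * r * a * y ^ 4) / y ^ 3)
      + Im t * ((r ^ 2 * y ^ 4 + 9 * a ^ 2 * y ^ 6 - 9 * p ^ 2 - q ^ 2 * y ^ 2) / y ^ 4)).
Proof.
  intros hy p q r.
  set (dx := fun x y =>
    2 * (3 * (a * x ^ 3 + b * x ^ 2 + c * x + d) * (3 * a * x ^ 2 + 2 * b * x + c)
      + 2 * (3 * a * x ^ 2 + 2 * b * x + c) * (3 * a * x + b) * y ^ 2 + 3 * (3 * a * x + b) * a * y ^ 4) * / y ^ 3).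
  apply (is_derive_filterdiff (fun x y => potential a b c d x y) x y dx).
  - assert (L : locally (x, y) (fun u : R * R => 0 < snd u)).
    { apply (open_comp snd (fun v => 0 < v)); [|apply open_gt|exact hy].
      intros; apply continuous_snd. }
    revert L; apply filter_imp; intros [x' y']; simpl; intros h.
    unfold potential, dx. auto_derive; [lra|]. field. lra.
  - unfold potential. auto_derive.
    { repeat split; auto; try lra. assert (0 < y ^ 3) by (apply pow_lt; auto). simpl in H; lra. }
    unfold p, q, r. field. lra.
  - unfold dx.
    apply (continuity_2d_pt_filterlim dx). unfold dx; simpl.
    repeat first [ apply continuity_2d_pt_plus | apply continuity_2d_pt_mult
      | apply continuity_2d_pt_const | apply continuity_2d_pt_id1
      | apply continuity_2d_pt_id2 | apply continuity_2d_pt_inv ].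
    assert (0 < y ^ 3) by (apply pow_lt; auto). simpl in *; lra.
Qed.

Lemma filterdiff_partials (V : C -> R) x y l :
  filterdiff (U := C_R_NormedModule) (V := R_NormedModule) V (locally (T := C_UniformSpace) (x, y)) l ->
  is_derive (fun u => V (u, y)) x (l (1, 0)) /\ is_derive (fun u => V (x, u)) y (l (0, 1)).
Proof.
  intros h.
  assert (lin := proj1 h).
  (* [V] is restated as a function of two real variables, the shape in which [filterdiff_comp'_2]
     composes it with the coordinate lines. *)
  assert (h' : filterdiff (fun t : prod_NormedModule R_AbsRing R_NormedModule R_NormedModule =>
     V (fst t, snd t)) (locally (x, y)) (fun t => l (fst t, snd t))).
  { apply (filterdiff_ext (U := C_R_NormedModule) V); [intros []; reflexivity|].
    apply (filterdiff_ext_lin (U := C_R_NormedModule) V l); [exact h|intros []; reflexivity]. }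
  split.
  - apply filterdiff_ext_lin with (fun u : R => l (u, 0)).
    + apply (filterdiff_comp'_2 (fun u : R => u) (fun _ : R => y) (fun a b => V (a, b)) x
        (fun u => u) (fun _ => 0) (fun a b => l (a, b))); auto.
      apply filterdiff_id. exact (filterdiff_const (U := R_NormedModule) (V := R_NormedModule) _).
    + intros u. rewrite <- (linear_scal l lin u (1, 0)). f_equal.
      apply injective_projections; simpl; symmetry; apply Rmult_1_r || apply Rmult_0_r.
  - apply filterdiff_ext_lin with (fun u : R => l (0, u)).
    + apply (filterdiff_comp'_2 (fun _ : R => x) (fun u : R => u) (fun a b => V (a, b)) y
        (fun _ => 0) (fun u => u) (fun a b => l (a, b))); auto.
      exact (filterdiff_const (U := R_NormedModule) (V := R_NormedModule) _). apply filterdiff_id.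
    + intros u. rewrite <- (linear_scal l lin u (0, 1)). f_equal.
      apply injective_projections; simpl; symmetry; apply Rmult_1_r || apply Rmult_0_r.
Qed.

Lemma critical_point_V_eff F x y : 0 < y ->
  let '(a, b, c, d) := real_coefs F in
  critical_point (V_eff F) (x, y) <-> attractor_at a b c d x y.
Proof.
  intros hy. assert (H := V_eff_xy F).
  destruct (real_coefs F) as [[[a b] c] d].
  assert (D := potential_filterdiff a b c d x y hy).
  cbv zeta in D.
  set (p := a * x ^ 3 + b * x ^ 2 + c * x + d) in *.
  set (q := 3 * a * x ^ 2 + 2 * b * x + c) in *.
  set (r := 3 * a * x + b) in *.
  set (X := 2 * (3 * p * q + 2 * q * r * y ^ 2 + 3 * r * a * y ^ 4) / y ^ 3) in *.
  set (Y := (r ^ 2 * y ^ 4 + 9 * a ^ 2 * y ^ 6 - 9 * p ^ 2 - q ^ 2 * y ^ 2) / y ^ 4) in *.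
  assert (L : locally (T := C_UniformSpace) (x, y) (fun u : C => 0 < Im u)).
  { apply (open_comp snd (fun v => 0 < v)); [|apply open_gt|exact hy].
    intros; apply continuous_snd. }
  assert (D' : filterdiff (U := C_R_NormedModule) (V := R_NormedModule)
    (V_eff F) (locally (T := C_UniformSpace) (x, y)) (fun t => Re t * X + Im t * Y)).
  { revert D. apply (filterdiff_ext_loc (U := C_R_NormedModule)
      (FF := filter_filter (ProperFilter := locally_filter (T := C_UniformSpace) (x, y)))).
    - revert L. apply filter_imp. intros [x' y'] h. symmetry. apply H, h.
    - intros z hz. apply (is_filter_lim_locally_unique (V := C_R_NormedModule) (x, y)) in hz.
      rewrite <- hz. symmetry; apply H, hy. }
  (* If the zero map is a differential too, its partial derivatives agree with those of [D'], which
     are [X] and [Y]. *)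
  assert (E : critical_point (V_eff F) (x, y) <-> (X = 0 /\ Y = 0)).
  { split.
    - intros hcr. split.
      + assert (K := is_derive_unique _ _ _ (proj1 (filterdiff_partials _ _ _ _ D'))).
        assert (K' := is_derive_unique _ _ _ (proj1 (filterdiff_partials _ _ _ _ hcr))).
        assert (K'' := eq_trans (eq_sym K) K'). unfold Re, Im in K''; simpl in K''. lra.
      + assert (K := is_derive_unique _ _ _ (proj2 (filterdiff_partials _ _ _ _ D'))).
        assert (K' := is_derive_unique _ _ _ (proj2 (filterdiff_partials _ _ _ _ hcr))).
        assert (K'' := eq_trans (eq_sym K) K'). unfold Re, Im in K''; simpl in K''. lra.
    - intros [-> ->]. unfold critical_point.
      apply (filterdiff_ext_lin (U := C_R_NormedModule) (V := R_NormedModule)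
        (FF := filter_filter (ProperFilter := locally_filter (T := C_UniformSpace) (x, y)))
        _ _ _ D').
      intros t. simpl. ring. }
  rewrite E. unfold attractor_at, attractor_equations. fold p q r.
  assert (hX : 3 * p * (q * y) + 2 * (q * y) * (r * y ^ 2) + 3 * (r * y ^ 2) * (a * y ^ 3)
    = X * (y ^ 4 / 2)) by (unfold X; field; lra).
  assert (hY : (r * y ^ 2) ^ 2 + 9 * (a * y ^ 3) ^ 2 - (9 * p ^ 2 + (q * y) ^ 2)
    = Y * y ^ 4) by (unfold Y; field; lra).
  assert (h4 : 0 < y ^ 4) by (apply pow_lt; auto).
  rewrite hX. split.
  - intros [zX zY]. rewrite zX, zY, ?Rmult_0_l in *. lra.
  - intros [zX zY]. split; [nra|]. assert (Y * y ^ 4 = 0) by lra. nra.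
Qed.

(** * Coefficients, discriminant and conjugation of the roots *)

Lemma cubic_coefs_unique (a b c d a' b' c' d' : C) :
  (forall X Y : C, (a * X ^ 3 + b * X ^ 2 * Y + c * X * Y ^ 2 + d * Y ^ 3
    = a' * X ^ 3 + b' * X ^ 2 * Y + c' * X * Y ^ 2 + d' * Y ^ 3)%C) ->
  a = a' /\ b = b' /\ c = c' /\ d = d'.
Proof.
  set (f := fun a b c d X Y : C => (a * X ^ 3 + b * X ^ 2 * Y + c * X * Y ^ 2 + d * Y ^ 3)%C).
  intros H. change (forall X Y, f a b c d X Y = f a' b' c' d' X Y) in H.
  assert (two : RtoC 2 <> 0) by (intros z; apply RtoC_inj in z; lra).
  (* The coefficients are recovered from the values at [(1, 0)], [(0, 1)], [(1, 1)] and
     [(1, -1)]. *)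
  assert (Ha : forall a b c d : C, a = f a b c d 1 0) by (intros; unfold f; ring).
  assert (Hd : forall a b c d : C, d = f a b c d 0 1) by (intros; unfold f; ring).
  assert (Hb : forall a b c d : C, b = ((f a b c d 1 1 - f a b c d 1 (-(1))) / 2 - f a b c d 0 1)%C)
    by (intros; unfold f; field; auto).
  assert (Hc : forall a b c d : C, c = ((f a b c d 1 1 + f a b c d 1 (-(1))) / 2 - f a b c d 1 0)%C)
    by (intros; unfold f; field; auto).
  repeat split.
  - rewrite (Ha a b c d), H. symmetry; apply Ha.
  - rewrite (Hb a b c d), !H. symmetry; apply Hb.
  - rewrite (Hc a b c d), !H. symmetry; apply Hc.
  - rewrite (Hd a b c d), H. symmetry; apply Hd.
Qed.

(** The scalar of a factorisation is complex, but the coefficients of [F] are real, so taking real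
    parts replaces [l] by [Re l]. *)
Lemma real_coefs_factor F (l : C) (a b c d : R) :
  (forall X Y : C, eval_form F X Y = (l * (a * X ^ 3 + b * X ^ 2 * Y + c * X * Y ^ 2 + d * Y ^ 3))%C) ->
  real_coefs F = (Re l * a, Re l * b, Re l * c, Re l * d).
Proof.
  intros H. destruct F as [fa fb fc fd].
  destruct (cubic_coefs_unique (Q2R fa) (Q2R fb) (Q2R fc) (Q2R fd) (l * a) (l * b) (l * c) (l * d))
    as (Ha & Hb & Hc & Hd).
  { intros X Y. unfold eval_form in H. rewrite H. ring. }
  unfold real_coefs; simpl.
  apply (f_equal Re) in Ha, Hb, Hc, Hd. unfold Re, Cmult, RtoC in *; simpl in *.
  rewrite Ha, Hb, Hc, Hd, !Rmult_0_r, !Rminus_0_r. reflexivity.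
Qed.

Lemma discriminant_real_coefs F :
  let '(a, b, c, d) := real_coefs F in Q2R (discriminant F) = cubic_disc a b c d.
Proof.
  destruct F as [a b c d]. unfold real_coefs, discriminant, cubic_disc; simpl coef_a; simpl coef_b;
  simpl coef_c; simpl coef_d.
  assert (h2 : forall x : Q, Q2R (x ^ 2) = Q2R x ^ 2).
  { intros x. change (x ^ 2)%Q with (x * x)%Q. rewrite Q2R_mult. ring. }
  assert (h3 : forall x : Q, Q2R (x ^ 3) = Q2R x ^ 3).
  { intros x. change (x ^ 3)%Q with (x * (x * x))%Q. rewrite !Q2R_mult. ring. }
  assert (h4 : Q2R 4 = 4) by (unfold Q2R; simpl; field).
  assert (h27 : Q2R 27 = 27) by (unfold Q2R; simpl; field).
  assert (h18 : Q2R 18 = 18) by (unfold Q2R; simpl; field).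
  unfold Qminus. repeat rewrite ?Q2R_plus, ?Q2R_opp, ?Q2R_mult, ?h2, ?h3, ?h4, ?h27, ?h18. ring.
Qed.

(* [p] is the point [num p : den p]; the sign at infinity makes
   [linear_form_num_den] hold. *)
Definition den (p : P1C) : C := match p with Some _ => RtoC 1 | None => RtoC 0 end.
Definition num (p : P1C) : C := match p with Some z => z | None => RtoC (-1) end.

Lemma linear_form_num_den p X Y : linear_form p X Y = (den p * X - num p * Y)%C.
Proof. destruct p; simpl; ring. Qed.

Lemma linear_form_zero p q : linear_form p (num q) (den q) = 0 <-> q = p.
Proof.
  destruct p as [z|], q as [w|]; simpl; split; intros H; try discriminate; auto.
  - f_equal. transitivity ((w - z * 1) + z)%C; [ring|]. rewrite H. ring.
  - injection H as ->. ring.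
  - apply (f_equal (fun w => Re (w + z * 0)%C)) in H.
    replace (RtoC (-1) - z * 0 + z * 0)%C with (RtoC (-1)) in H by ring.
    unfold Re, Cmult, Cplus, RtoC in H; simpl in H. lra.
  - apply RtoC_inj in H. lra.
Qed.

Definition P1conj (p : P1C) : P1C := option_map Cconj p.

Lemma P1conj_involutive p : P1conj (P1conj p) = p.
Proof. destruct p; simpl; [rewrite Cconj_conj|]; reflexivity. Qed.

Lemma Cconj_RtoC x : Cconj (RtoC x) = RtoC x.
Proof. unfold Cconj, RtoC; simpl. f_equal. ring. Qed.

Lemma num_conj p : num (P1conj p) = Cconj (num p).
Proof. destruct p; simpl; [|rewrite Cconj_RtoC]; reflexivity. Qed.

Lemma den_conj p : den (P1conj p) = Cconj (den p).
Proof. destruct p; simpl; rewrite Cconj_RtoC; reflexivity. Qed.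

Lemma eval_form_conj F X Y : eval_form F (Cconj X) (Cconj Y) = Cconj (eval_form F X Y).
Proof.
  destruct F. unfold eval_form.
  rewrite ?Cplus_conj, ?Cmult_conj, ?Cpow_conj, ?Cconj_RtoC. reflexivity.
Qed.

Lemma roots_eval F alpha beta gamma p :
  roots F alpha beta gamma ->
  eval_form F (num p) (den p) = 0 <-> p = alpha \/ p = beta \/ p = gamma.
Proof.
  intros (l & hl & H). rewrite H. split.
  - intros Z. rewrite <- !linear_form_zero.
    destruct (Ceq_dec (linear_form alpha (num p) (den p)) 0) as [|na]; [tauto|].
    destruct (Ceq_dec (linear_form beta (num p) (den p)) 0) as [|nb]; [tauto|].
    destruct (Ceq_dec (linear_form gamma (num p) (den p)) 0) as [|nc]; [tauto|].
    exfalso. revert Z. repeat apply Cmult_neq_0; auto.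
  - intros [Z|[Z|Z]]; apply linear_form_zero in Z; rewrite Z; ring.
Qed.

Lemma roots_conj F alpha beta gamma p :
  roots F alpha beta gamma -> p = alpha \/ p = beta \/ p = gamma ->
  P1conj p = alpha \/ P1conj p = beta \/ P1conj p = gamma.
Proof.
  intros H. rewrite <- !(roots_eval F alpha beta gamma) by auto.
  rewrite num_conj, den_conj, eval_form_conj. intros ->. apply Cconj_RtoC.
Qed.

Lemma roots_swap12 F alpha beta gamma : roots F alpha beta gamma -> roots F beta alpha gamma.
Proof. intros (l & hl & H). exists l. split; auto. intros. rewrite H. ring. Qed.

Lemma roots_swap23 F alpha beta gamma : roots F alpha beta gamma -> roots F alpha gamma beta.
Proof. intros (l & hl & H). exists l. split; auto. intros. rewrite H. ring. Qed.

Lemma roots_double F alpha gamma : roots F alpha alpha gamma -> (discriminant F == 0)%Q.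
Proof.
  intros (l & hl & H). apply eqR_Qeq.
  assert (D := discriminant_real_coefs F). unfold real_coefs in D. rewrite D. clear D.
  set (e := den alpha) in *. set (f := num alpha) in *. set (e' := den gamma) in *. set (f' := num gamma) in *.
  destruct (cubic_coefs_unique (Q2R (coef_a F)) (Q2R (coef_b F)) (Q2R (coef_c F)) (Q2R (coef_d F))
     (l * (e * e * e')) (- l * (2 * f * e * e' + e * e * f'))
     (l * (f * f * e' + 2 * e * f * f')) (- l * (f * f * f')))
    as (Ha & Hb & Hc & Hd).
  { intros X Y. transitivity (eval_form F X Y); [destruct F; reflexivity|].
    rewrite H, !linear_form_num_den. fold e f e' f'. ring. }
  apply RtoC_inj. unfold cubic_disc.
  repeat rewrite ?RtoC_plus, ?RtoC_minus, ?RtoC_mult, ?RtoC_pow.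
  rewrite Ha, Hb, Hc, Hd. replace (Q2R 0) with 0 by (unfold Q2R; simpl; ring). ring.
Qed.

(** Conjugation acts on the three distinct roots as an involution, so it fixes all of them or swaps
    two and fixes the third. *)
Lemma roots_conjugation_cases F alpha beta gamma :
  ~ (discriminant F == 0)%Q -> roots F alpha beta gamma ->
  (P1conj alpha = alpha /\ P1conj beta = beta /\ P1conj gamma = gamma) \/
  (P1conj alpha = alpha /\ gamma = P1conj beta) \/
  (P1conj beta = beta /\ gamma = P1conj alpha) \/
  (P1conj gamma = gamma /\ beta = P1conj alpha).
Proof.
  intros hd H.
  assert (hab : alpha <> beta) by (intros <-; apply hd, (roots_double _ _ _ H)).
  assert (hac : alpha <> gamma)
    by (intros <-; apply hd, (roots_double F alpha beta), roots_swap23, H).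
  assert (hbc : beta <> gamma)
    by (intros <-; apply hd, (roots_double F beta alpha), roots_swap23, roots_swap12, H).
  assert (Ka := roots_conj _ _ _ _ alpha H). assert (Kb := roots_conj _ _ _ _ beta H).
  assert (Kc := roots_conj _ _ _ _ gamma H).
  assert (inj : forall p q, P1conj p = P1conj q -> p = q).
  { intros p q E. rewrite <- (P1conj_involutive p), E. apply P1conj_involutive. }
  assert (inv := P1conj_involutive alpha). assert (inv' := P1conj_involutive beta).
  assert (inv'' := P1conj_involutive gamma).
  destruct Ka as [Ka|[Ka|Ka]]; auto; destruct Kb as [Kb|[Kb|Kb]]; auto;
  destruct Kc as [Kc|[Kc|Kc]]; auto; try (exfalso; congruence); tauto.
Qed.

(** * Balance of the roots at every attractor point *)

Lemma real_point_num_den p : P1conj p = p -> num p = RtoC (Re (num p)) /\ den p = RtoC (Re (den p)).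
Proof.
  intros hp. destruct p as [[z1 z2]|]; [|split; reflexivity].
  injection hp as hz. split; [|reflexivity]. simpl. unfold RtoC. f_equal. lra.
Qed.

(** [[g : e]] is the image of [p] under [z -> (z - x) / y], which takes [x + iy] to [i]. *)
Lemma ideal_direction_real x y p :
  0 < y -> P1conj p = p ->
  let e := Re (den p) * y in let g := Re (num p) - Re (den p) * x in
  ideal_direction (RtoC x, y) p =
  (2 * e * g / (g ^ 2 + e ^ 2), 0, (g ^ 2 - e ^ 2) / (g ^ 2 + e ^ 2)).
Proof.
  intros hy hp e g. unfold e, g.
  destruct p as [[z1 z2]|]; simpl num; simpl den; unfold ideal_direction.
  - injection hp as hz. assert (z2 = 0) by lra. subst z2.
    rewrite Cmod_sqr. unfold Cminus, Cplus, Copp, RtoC, Re, Im; simpl fst; simpl snd.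
    assert (h := sum_squares_pos 0 (z1 + - x) y hy).
    f_equal; [f_equal|]; field; lra.
  - unfold Re, RtoC; simpl fst. f_equal; [f_equal|]; field; lra.
Qed.

(** Being symmetric in the roots, this property needs to be proved for one ordering in each type of
    conjugation action. *)
Definition attractor_balanced (F : cubic_form) (alpha beta gamma : P1C) : Prop :=
  let '(a, b, c, d) := real_coefs F in
  (exists x y, 0 < y /\ attractor_at a b c d x y) /\
  forall x y, 0 < y -> attractor_at a b c d x y -> balanced alpha beta gamma (RtoC x, y).

Lemma balanced_swap12 alpha beta gamma P :
  balanced alpha beta gamma P -> balanced beta alpha gamma P.
Proof.
  unfold balanced.
  destruct (ideal_direction P alpha) as [[a1 a2] a3], (ideal_direction P beta) as [[b1 b2] b3],
    (ideal_direction P gamma) as [[c1 c2] c3]. lra.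
Qed.

Lemma balanced_swap23 alpha beta gamma P :
  balanced alpha beta gamma P -> balanced alpha gamma beta P.
Proof.
  unfold balanced.
  destruct (ideal_direction P alpha) as [[a1 a2] a3], (ideal_direction P beta) as [[b1 b2] b3],
    (ideal_direction P gamma) as [[c1 c2] c3]. lra.
Qed.

Lemma attractor_balanced_swap12 F alpha beta gamma :
  attractor_balanced F alpha beta gamma -> attractor_balanced F beta alpha gamma.
Proof.
  unfold attractor_balanced. destruct (real_coefs F) as [[[a b] c] d].
  intros [h1 h2]; split; auto using balanced_swap12.
Qed.

Lemma attractor_balanced_swap23 F alpha beta gamma :
  attractor_balanced F alpha beta gamma -> attractor_balanced F alpha gamma beta.
Proof.
  unfold attractor_balanced. destruct (real_coefs F) as [[[a b] c] d].
  intros [h1 h2]; split; auto using balanced_swap23.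
Qed.

(** The substitution of [yX + xY] for [X] has determinant [y], and the discriminant of a cubic has
    weight 6. A nonzero discriminant thus survives moving the base point to [i]. *)
Lemma cubic_disc_taylor a b c d x y :
  cubic_disc (a * y ^ 3) ((3 * a * x + b) * y ^ 2) ((3 * a * x ^ 2 + 2 * b * x + c) * y)
    (a * x ^ 3 + b * x ^ 2 + c * x + d) = y ^ 6 * cubic_disc a b c d.
Proof. unfold cubic_disc; ring. Qed.

Lemma attractor_balanced_real F alpha beta gamma :
  ~ (discriminant F == 0)%Q -> roots F alpha beta gamma ->
  P1conj alpha = alpha -> P1conj beta = beta -> P1conj gamma = gamma ->
  attractor_balanced F alpha beta gamma.
Proof.
  intros hd (l & hl & H) ra rb rc.
  assert (D := discriminant_real_coefs F).
  unfold attractor_balanced.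
  assert (Ia := fun x y hy => ideal_direction_real x y alpha hy ra).
  assert (Ib := fun x y hy => ideal_direction_real x y beta hy rb).
  assert (Ic := fun x y hy => ideal_direction_real x y gamma hy rc).
  destruct (real_point_num_den alpha ra) as [na da].
  destruct (real_point_num_den beta rb) as [nb db].
  destruct (real_point_num_den gamma rc) as [nc dc].
  set (f1 := Re (num alpha)) in *. set (e1 := Re (den alpha)) in *.
  set (f2 := Re (num beta)) in *. set (e2 := Re (den beta)) in *.
  set (f3 := Re (num gamma)) in *. set (e3 := Re (den gamma)) in *.
  assert (HC := real_coefs_factor F l (e1 * e2 * e3) (- (f1 * e2 * e3 + e1 * f2 * e3 + e1 * e2 * f3))
    (f1 * f2 * e3 + f1 * e2 * f3 + e1 * f2 * f3) (- (f1 * f2 * f3))).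
  lapply HC; clear HC.
  2: { intros X Y. rewrite H, !linear_form_num_den, na, nb, nc, da, db, dc.
       repeat rewrite ?RtoC_opp, ?RtoC_plus, ?RtoC_mult. ring. }
  intros HC. rewrite HC in D |- *.
  set (L := Re l) in *.
  match type of D with _ = ?d => assert (hd' : d <> 0) end.
  { rewrite <- D. intros z. apply hd, eqR_Qeq. rewrite z. unfold Q2R; simpl; ring. }
  split.
  - apply attractor_exists_pos.
    (* With three real roots the discriminant is a square; being nonzero, it is positive. *)
    match goal with |- 0 < ?d => assert (0 <= d); [|lra] end.
    match goal with |- 0 <= ?d => replace d with
     ((L ^ 2 * ((f1 * e2 - f2 * e1) * (f1 * e3 - f3 * e1) * (f2 * e3 - f3 * e2))) ^ 2)
     by (unfold cubic_disc; ring) end.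
    apply pow2_ge_0.
  - intros x y hy hat. unfold balanced. rewrite Ia, Ib, Ic by auto.
    rewrite Rplus_0_l, Rplus_0_l.
    destruct (fun hs hr hq hp hd => balanced_real L (f1 - e1 * x) (e1 * y) (f2 - e2 * x) (e2 * y)
      (f3 - e3 * x) (e3 * y) _ _ _ _ hs hr hq hp hd hat) as [K1 K2]; try ring.
    + rewrite cubic_disc_taylor. apply Rmult_integral_contrapositive_currified; auto.
      apply pow_nonzero; lra.
    + auto.
Qed.

Lemma attractor_balanced_pair F alpha beta :
  ~ (discriminant F == 0)%Q -> roots F alpha beta (P1conj beta) ->
  P1conj alpha = alpha ->
  attractor_balanced F alpha beta (P1conj beta).
Proof.
  intros hd hroots ra.
  (* The point at infinity is its own conjugate, so in that case all three roots are real. *)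
  destruct beta as [[m k]|]; [|apply attractor_balanced_real; auto].
  destruct hroots as (l & hl & H).
  assert (D := discriminant_real_coefs F).
  unfold attractor_balanced.
  assert (Ia := fun x y hy => ideal_direction_real x y alpha hy ra).
  destruct (real_point_num_den alpha ra) as [na da].
  set (f := Re (num alpha)) in *. set (e := Re (den alpha)) in *.
  assert (HC := real_coefs_factor F l e (- (f + 2 * m * e))
    (e * (m ^ 2 + k ^ 2) + 2 * m * f) (- (f * (m ^ 2 + k ^ 2)))).
  lapply HC; clear HC.
  2: { intros X Y. rewrite H, (linear_form_num_den alpha), na, da. simpl linear_form.
       transitivity (l * (e * X - f * Y) *
         (X * X - ((m, k) + Cconj (m, k)) * X * Y + ((m, k) * Cconj (m, k)) * Y * Y))%C; [ring|].
       replace ((m, k) + Cconj (m, k))%C with (RtoC (2 * m))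
         by (unfold Cconj, Cplus, RtoC; simpl; f_equal; ring).
       replace ((m, k) * Cconj (m, k))%C with (RtoC (m ^ 2 + k ^ 2))
         by (unfold Cconj, Cmult, RtoC; simpl; f_equal; ring).
       set (M := m ^ 2 + k ^ 2).
       repeat rewrite ?RtoC_opp, ?RtoC_plus, ?RtoC_mult. ring. }
  intros HC. rewrite HC in D |- *.
  set (L := Re l) in *.
  match type of D with _ = ?d => assert (hd' : d <> 0) end.
  { rewrite <- D. intros z. apply hd, eqR_Qeq. rewrite z. unfold Q2R; simpl; ring. }
  split.
  - replace (L * - (f + 2 * m * e)) with (- L * (f + 2 * m * e)) in * by ring.
    replace (L * - (f * (m ^ 2 + k ^ 2))) with (- L * (f * (m ^ 2 + k ^ 2))) in * by ring.
    apply attractor_exists_pair; auto.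
  - intros x y hy hat. unfold balanced. rewrite Ia by auto.
    (* Moving [x + iy] to [i] sends [m + ik] to [((m - x) + ik) / y]; the quadratic factor then
       releases [y^2], which joins the scalar [L]. *)
    destruct (fun hs hr hq hp hd => balanced_pair (L * y ^ 2) (f - e * x) (e * y) ((m - x) / y) (k / y)
      _ _ _ _ hs hr hq hp hd hat) as [K1 K2]; try (field; lra).
    + rewrite cubic_disc_taylor. apply Rmult_integral_contrapositive_currified; auto.
      apply pow_nonzero; lra.
    + simpl P1conj. unfold ideal_direction. rewrite !Cmod_sqr.
      unfold Cminus, Cplus, Copp, Cconj, RtoC, Re, Im; simpl fst; simpl snd.
      set (n := (m + - x) ^ 2 + (k + - 0) ^ 2 + y ^ 2).
      assert (hn : 0 < n) by (apply sum_squares_pos; auto).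
      replace ((m + - x) ^ 2 + (- k + - 0) ^ 2 + y ^ 2) with n by (unfold n; ring).
      repeat split.
      * rewrite Rplus_assoc. eapply eq_trans, K1. f_equal. unfold n in *. field.
        repeat split; lra.
      * field. lra.
      * rewrite Rplus_assoc. eapply eq_trans, K2. f_equal. unfold n in *. field.
        repeat split; lra.
Qed.

Lemma roots_attractor_balanced F alpha beta gamma :
  ~ (discriminant F == 0)%Q -> roots F alpha beta gamma ->
  attractor_balanced F alpha beta gamma.
Proof.
  intros hd H.
  destruct (roots_conjugation_cases F alpha beta gamma hd H) as [(?&?&?)|[[? ->]|[[? ->]|[? ->]]]].
  - apply attractor_balanced_real; auto.
  - apply attractor_balanced_pair; auto.
  - apply attractor_balanced_swap12, attractor_balanced_pair; auto using roots_swap12.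
  - apply attractor_balanced_swap23, attractor_balanced_swap12, attractor_balanced_pair;
    auto using roots_swap12, roots_swap23.
Qed.

Theorem theorem1p0p10 (F : cubic_form) (alpha beta gamma : P1C)
  (hdisc : ~ (discriminant F == 0)%Q)
  (hroots : roots F alpha beta gamma) :
  exists tau : C,
    unique (attractor_point F) tau /\
    center_of_mass alpha beta gamma (embed_half_plane tau).
Proof.
  assert (crit := critical_point_V_eff F).
  assert (B := roots_attractor_balanced F alpha beta gamma hdisc hroots).
  unfold attractor_balanced in B.
  destruct (real_coefs F) as [[[a b] c] d].
  destruct B as [(x & y & hy & hat) B].
  assert (com : forall x y, 0 < y -> attractor_at a b c d x y ->
    center_of_mass alpha beta gamma (RtoC x, y))
    by (intros; apply balanced_center_of_mass; auto).
  exists (x, y). split; [split|].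
  - split; [exact hy|]. apply crit; auto.
  - intros [x' y'] [hy' hcr]. apply crit in hcr; [|exact hy'].
    destruct (com x y hy hat) as [_ U].
    destruct (com x' y' hy' hcr) as [M _].
    assert (E := U _ M). injection E as -> ->. reflexivity.
  - apply com; auto.
Qed.
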